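(* For all $\alpha,\beta,\gamma\in\mathbb{Q}$ such that $0\le\alpha,\beta,\gamma<1$ and $\alpha+\beta+\gamma=1$, there is a 4-regular map gadget having signature $(\alpha,\beta,\gamma)$.
   Context: A 4-regular graph gadget is a finite undirected graph (parallel edges and loops allowed) together with exactly four half-edges, labelled $0,1,2,3$, each incident with exactly one vertex, such that every vertex has degree 4 (counting half-edges, and loops twice). A 4-regular map gadget is a 4-regular graph gadget together with, at each vertex $v$, a cyclic ordering $O^+(v)=(e_1,e_2,e_3,e_4)$ of the four edge-ends and half-edges at $v$; $e_i$ and $e_{i+1}$ ($e_5:=e_1$) are called cyclicly-adjacent. No planarity is assumed. A route is a trail (no repeated edges, repeated vertices allowed) starting with one half-edge and ending with another. A valid set of routes is a set of two routes such that every edge and every half-edge is travelled exactly once (routes are considered up to reversal); equivalently, it is a choice at every vertex of a perfect matching of the four edge-ends/half-edges at it such that following the matchings yields two trails joining the four half-edges in pairs and no closed trails. In a map gadget, only routes in which consecutive edges/half-edges at every vertex are cyclicly-adjacent are allowed. $\mathrm{VR}(\{a,b\},\{c,d\})$ denotes the set of valid sets of routes in which one route connects half-edges $a,b$ and the other connects $c,d$. The signature of a gadget is the triple $(\alpha,\beta,\gamma)$ with $\alpha=|\mathrm{VR}(\{0,1\},\{2,3\})|/N$, $\beta=|\mathrm{VR}(\{0,2\},\{1,3\})|/N$, $\gamma=|\mathrm{VR}(\{0,3\},\{1,2\})|/N$, where $N$ is the sum of the three cardinalities (defined when $N>0$). *)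

(* Defs.v *)
From HB Require Import structures.
From mathcomp Require Import all_boot all_order all_algebra.
Set Implicit Arguments. Unset Strict Implicit. Unset Printing Implicit Defensive.
Import Order.TTheory GRing.Theory Num.Theory.
Local Open Scope ring_scope.

(* The two ends of the edge [e] are [inl (e, false)] and [inl (e, true)], so
   loops and parallel edges are allowed and a loop contributes two to the degree
   of its vertex; the naming of the two ends is not part of the structure.
   [inr i] is the half-edge labelled [i]. *)
Definition end_of (E : finType) : finType := ((E * bool) + 'I_4)%type.

Record graph_gadget : Type := GraphGadget {
  vertex : finType;
  edge : finType;
  incident : end_of edge -> vertex;
  degree4 : forall v : vertex, #|[set x | incident x == v]| = 4%N }.

(* [rotation v] is the cyclic ordering at [v], written as a list starting from
   an arbitrary one of the four ends at [v]. *)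
Record map_gadget : Type := MapGadget {
  graph_of :> graph_gadget;
  rotation : vertex graph_of -> 4.-tuple (end_of (edge graph_of));
  rotationP : forall v : vertex graph_of,
    perm_eq (rotation v) (enum [set x | incident x == v]) }.

Section Routes.
Variable G : map_gadget.
Implicit Types (x y : end_of (edge G)) (p q : seq (edge G * bool)).
Implicit Types a b c d : 'I_4.

Definition cyclicly_adjacent x y : bool :=
  [&& incident x == incident y,
      x \in rotation (incident x), y \in rotation (incident x) &
      (next (rotation (incident x)) x == y)
      || (next (rotation (incident x)) y == x)].

(* An item [(e, s)] of [p] means that the edge [e] is travelled from its end
   [(e, s)] to its end [(e, ~~ s)]. [allowed_walk x p y] starts at the vertex of
   [x], having arrived there through [x], travels [p], and finally leaves the
   vertex it has reached through [y]. The two directions of travel of a loop make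
   different routes, as they pair the ends at its vertex differently. *)
Fixpoint allowed_walk x p y : bool :=
  if p is t :: p' then
    cyclicly_adjacent x (inl t) && allowed_walk (inl (t.1, ~~ t.2)) p' y
  else cyclicly_adjacent x y.

Definition travelled p : seq (edge G) := [seq t.1 | t <- p].

Definition is_route a b p : bool :=
  [&& a != b, uniq (travelled p) & allowed_walk (inr a) p (inr b)].

Definition valid_routes a b c d p q : bool :=
  [&& uniq [:: a; b; c; d], is_route a b p, is_route c d q &
      perm_eq (travelled p ++ travelled q) (enum (edge G))].

Local Notation trail_seq := (#|edge G|.-bseq (edge G * bool)).

(* VR({a,b},{c,d}). As a, b, c, d are distinct, each set of two routes taken up
   to reversal has exactly one representative (p, q) with p directed from a to b
   and q directed from c to d. A trail has at most #|edge G| edges, so bounding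
   the length of p and q loses nothing. *)
Definition VR a b c d : {set trail_seq * trail_seq} :=
  [set r : trail_seq * trail_seq | valid_routes a b c d r.1 r.2].

Local Notation half i := (@Ordinal 4 i isT).

Definition nVR01_23 : nat := #|VR (half 0) (half 1) (half 2) (half 3)|.
Definition nVR02_13 : nat := #|VR (half 0) (half 2) (half 1) (half 3)|.
Definition nVR03_12 : nat := #|VR (half 0) (half 3) (half 1) (half 2)|.
Definition nVR : nat := (nVR01_23 + nVR02_13 + nVR03_12)%N.

Definition signature : rat * rat * rat :=
  (nVR01_23%:R / nVR%:R, nVR02_13%:R / nVR%:R, nVR03_12%:R / nVR%:R).

Definition has_signature (s : rat * rat * rat) : Prop :=
  (0 < nVR)%N /\ signature = s.

End Routes.

(* Main.v *)
(* Write the three numbers of valid sets of routes as a triple (a, b, c). One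
   vertex gives (1, 0, 1), and relabelling the half-edges permutes the triple.
   Linking the half-edges 2, 3 of a gadget (a, b, c) to the half-edges 0, 1 of a
   gadget (a', b', c') gives
     (a (b' + c') + a' (b + c), b b' + c c', b c' + c b'),
   as one sees by cutting the routes at the two link edges, each travelled once.
   Composing with (1, 1, 0) sends (a, b, 0) to (a + b, b, 0), so running the
   Euclidean algorithm backwards yields all (x, y, 0) with x, y > 0 up to scaling;
   then (0, y, z) composed with (x, y + z, 0) is (y + z) (x, y, z). *)

Require Import Defs.
From HB Require Import structures.
From mathcomp Require Import all_boot all_order all_algebra.
From mathcomp Require Import perm zify ring.
Set Implicit Arguments. Unset Strict Implicit. Unset Printing Implicit Defensive.
Import Order.TTheory GRing.Theory Num.Theory.
Local Open Scope nat_scope.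

Local Notation h i := (@Ordinal 4 i isT).

(** * Routes *)

Section Routes.
Variable G : map_gadget.
Implicit Types (x y z : end_of (edge G)) (p q : seq (edge G * bool)).
Implicit Types a b c d : 'I_4.

Lemma rotation_uniq (v : vertex G) : uniq (rotation v).
Proof. by rewrite (perm_uniq (rotationP v)) enum_uniq. Qed.

Lemma mem_rotation (v : vertex G) x : (x \in rotation v) = (incident x == v).
Proof. by rewrite (perm_mem (rotationP v)) mem_enum inE. Qed.

Lemma cyclicly_adjacentE x y :
  cyclicly_adjacent x y = (incident x == incident y) &&
    ((next (rotation (incident x)) x == y) ||
     (next (rotation (incident x)) y == x)).
Proof.
rewrite /cyclicly_adjacent !mem_rotation eqxx.
by case: eqVneq => // ->; rewrite eqxx.
Qed.

Lemma cyclicly_adjacent_sym : symmetric (@cyclicly_adjacent G).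
Proof.
move=> x y; rewrite !cyclicly_adjacentE eq_sym.
by case: eqP => //= ->; rewrite orbC.
Qed.

Lemma allowed_walk_cat x p t q y :
  allowed_walk x (p ++ t :: q) y =
    allowed_walk x p (inl t) && allowed_walk (inl (t.1, ~~ t.2)) q y.
Proof. by elim: p x => //= u p IH x; rewrite IH andbA. Qed.

Definition reverse p := rev [seq (t.1, ~~ t.2) | t <- p].

Lemma reverseK : involutive reverse.
Proof.
move=> p; rewrite /reverse map_rev revK -map_comp map_id_in // => -[e s] _ /=.
by rewrite negbK.
Qed.

Lemma travelled_reverse p : travelled (reverse p) = rev (travelled p).
Proof. by rewrite /travelled /reverse map_rev -map_comp. Qed.

Lemma allowed_walk_reverse x p y :
  allowed_walk x (reverse p) y = allowed_walk y p x.
Proof.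
elim: p y x => [|[e s] p IH] y x /=; first by rewrite cyclicly_adjacent_sym.
rewrite /reverse /= rev_cons -cats1 allowed_walk_cat /= IH negbK andbC.
by rewrite cyclicly_adjacent_sym.
Qed.

(** A duplicate-free concatenation has duplicate-free parts, so the trail condition is recovered
    from the joint covering of the edges; [a != b] and [c != d] come from the distinctness of the
    four labels. *)
Lemma valid_routesE a b c d p q :
  valid_routes a b c d p q =
    [&& uniq [:: a; b; c; d], allowed_walk (inr a) p (inr b),
        allowed_walk (inr c) q (inr d) &
        perm_eq (travelled p ++ travelled q) (enum (edge G))].
Proof.
rewrite /valid_routes /is_route; case abcd: (uniq _) => //=.
move: abcd; rewrite /= !inE !negb_or => /and4P[/and3P[-> _ _] _ -> _] /=.
case pq: (perm_eq _ _); last by rewrite !andbF.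
move: (perm_uniq pq); rewrite enum_uniq cat_uniq => /and3P[-> _ ->].
by rewrite /= !andbT.
Qed.

(** Plain sequences replace the bounded ones of [VR], so that routes can be cut, glued and reversed
    without length proofs. *)
Definition route_pairs a b c d :=
  [seq (val r.1, val r.2) | r <- enum (VR G a b c d)].

Lemma size_route_pairs a b c d : size (route_pairs a b c d) = #|VR G a b c d|.
Proof. by rewrite size_map cardE. Qed.

Lemma route_pairs_uniq a b c d : uniq (route_pairs a b c d).
Proof.
by rewrite map_inj_uniq ?enum_uniq // => -[p q] [p' q'] [] /val_inj-> /val_inj->.
Qed.

(** The two lengths add up to the number of edges, so both respect the bound built into [VR]. *)
Lemma mem_route_pairs a b c d (r : seq (edge G * bool) * seq (edge G * bool)) :
  (r \in route_pairs a b c d) = valid_routes a b c d r.1 r.2.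
Proof.
apply/mapP/idP => [[s]|]; first by rewrite mem_enum inE => V ->.
case: r => p q /= V.
have /andP[sp sq] : (size p <= #|edge G|) && (size q <= #|edge G|).
  move: V; rewrite valid_routesE => /and4P[_ _ _ /perm_size].
  rewrite size_cat !size_map => pq.
  have <- : size p + size q = #|edge G| by rewrite pq cardT enumT.
  by rewrite leq_addr leq_addl.
exists (Bseq sp, Bseq sq) => //.
by rewrite mem_enum inE.
Qed.

Lemma card_VR a b c d L : uniq L ->
  (forall r : seq (edge G * bool) * seq (edge G * bool),
     (r \in L) = valid_routes a b c d r.1 r.2) -> #|VR G a b c d| = size L.
Proof.
move=> uL LP; rewrite -size_route_pairs.
apply: perm_size; apply: uniq_perm; rewrite ?route_pairs_uniq // => r.
by rewrite mem_route_pairs LP.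
Qed.

Lemma card_VR_swap a b c d : #|VR G a b c d| = #|VR G c d a b|.
Proof.
rewrite -[RHS]size_route_pairs -(size_map (fun r => (r.2, r.1))).
have inj : injective (fun r : seq (edge G * bool) * seq (edge G * bool) => (r.2, r.1)).
  by move=> [p1 q1] [p' q'] [-> ->].
apply: card_VR => [|[p q]]; first by rewrite map_inj_uniq // route_pairs_uniq.
rewrite (mem_map inj _ (q, p)) mem_route_pairs !valid_routesE.
rewrite perm_catC -(rot_uniq 2 [:: a; b; c; d]).
by congr (_ && _); rewrite andbCA.
Qed.

(** Reversing the second route is an involution that exchanges its endpoints and permutes its
    travelled edges. *)
Lemma card_VR_reverse a b c d : #|VR G a b c d| = #|VR G a b d c|.
Proof.
rewrite -[RHS]size_route_pairs -(size_map (fun r => (r.1, reverse r.2))).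
have inj : injective
    (fun r : seq (edge G * bool) * seq (edge G * bool) => (r.1, reverse r.2)).
  by apply: (can_inj (g := fun r => (r.1, reverse r.2))) => -[p q] /=; rewrite reverseK.
apply: card_VR => [|[p q]]; first by rewrite map_inj_uniq // route_pairs_uniq.
rewrite -[q in (p, q) \in _]reverseK (mem_map inj _ (p, reverse q)).
rewrite mem_route_pairs !valid_routesE /= allowed_walk_reverse travelled_reverse.
have -> : perm_eq (travelled p ++ rev (travelled q)) =1 perm_eq (travelled p ++ travelled q).
  by apply/permPl; rewrite perm_cat2l perm_rev.
congr (_ && _).
by rewrite /= !inE (eq_sym d c); do !case: (_ == _).
Qed.

Lemma card_VR_reverse1 a b c d : #|VR G a b c d| = #|VR G b a c d|.
Proof. by rewrite card_VR_swap card_VR_reverse card_VR_swap. Qed.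

End Routes.

(** * Building gadgets *)

(** The degree is read off the rotation, a duplicate-free list of length four; a construction then
    only has to supply rotations with the right members. *)
Lemma degree4_of (V E : finType) (inc : end_of E -> V) (rot : V -> 4.-tuple (end_of E)) :
  (forall v, uniq (rot v)) -> (forall v x, (x \in rot v) = (inc x == v)) ->
  forall v, #|[set x | inc x == v]| = 4.
Proof.
move=> rU rM v; rewrite -(size_tuple (rot v)) -(card_uniqP (rU v)).
by apply: eq_card => x; rewrite inE rM.
Qed.

Lemma rotationP_of (V E : finType) (inc : end_of E -> V) (rot : V -> 4.-tuple (end_of E)) :
  (forall v, uniq (rot v)) -> (forall v x, (x \in rot v) = (inc x == v)) ->
  forall v, perm_eq (rot v) (enum [set x | inc x == v]).
Proof.
move=> rU rM v; apply: uniq_perm; rewrite ?enum_uniq // => x.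
by rewrite mem_enum inE rM.
Qed.

Definition gadget_of (V E : finType) (inc : end_of E -> V) (rot : V -> 4.-tuple (end_of E))
    (rU : forall v, uniq (rot v)) (rM : forall v x, (x \in rot v) = (inc x == v)) :=
  @MapGadget (GraphGadget (degree4_of rU rM)) rot (rotationP_of rU rM).

Lemma next_transport (T T' : eqType) (f : T -> T') (s : seq T) x y :
  injective f -> uniq s -> (next (map f s) (f x) == f y) = (next s x == y).
Proof. by move=> fI sU; rewrite next_map // (inj_eq fI). Qed.

(** * The gadget with one vertex and no edges *)

Section SingleVertex.

Let inc (x : end_of void) : unit := tt.
Let rot (v : unit) : 4.-tuple (end_of void) :=
  [tuple inr (h 0); inr (h 1); inr (h 2); inr (h 3)].

Let rotU v : uniq (rot v). Proof. by []. Qed.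
Let rotM v x : (x \in rot v) = (inc x == v).
Proof. by case: v; rewrite /rot /inc; case: x => [[[]]|[[|[|[|[|]]]] ?]]. Qed.

Definition single_vertex : map_gadget := gadget_of rotU rotM.

Lemma card_VR_single_vertex a b c d :
  #|@VR single_vertex a b c d| =
    @valid_routes single_vertex a b c d [::] [::] :> nat.
Proof.
have nilE (p : seq (edge single_vertex * bool)) : p = [::] by case: p => [|[[]]].
(* A boolean serves as a length: the list holds the pair of empty routes once or not at all. *)
rewrite -[RHS](size_nseq _ ([::] : seq (void * bool), [::] : seq (void * bool))).
apply: card_VR; first by case: valid_routes.
by move=> [p q]; rewrite (nilE p) (nilE q) /= mem_nseq eqxx andbT lt0b.
Qed.

Lemma nVR_single_vertex :
  [/\ nVR01_23 single_vertex = 1, nVR02_13 single_vertex = 0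
    & nVR03_12 single_vertex = 1].
Proof.
rewrite /nVR01_23 /nVR02_13 /nVR03_12 !card_VR_single_vertex !valid_routesE /=.
have -> : enum (edge single_vertex) = [::] by case: (enum _) => [|[]].
by [].
Qed.

End SingleVertex.

(** * Permuting the half-edge labels *)

Section Relabel.
Variables (G : map_gadget) (pi : 'I_4 -> 'I_4).
Hypothesis piK : involutive pi.

Let f (x : end_of (edge G)) : end_of (edge G) :=
  match x with inl t => inl t | inr i => inr (pi i) end.

Let fK : involutive f. Proof. by case=> //= i; rewrite piK. Qed.
Let f_inj : injective f := can_inj fK.

Let rot v := map_tuple f (rotation v).
Let rotU v : uniq (rot v). Proof. by rewrite map_inj_uniq // rotation_uniq. Qed.
Let rotM v x : (x \in rot v) = (incident (f x) == v).
Proof. by rewrite -[x in LHS]fK mem_map // mem_rotation. Qed.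

Definition relabel : map_gadget := gadget_of rotU rotM.

Lemma relabel_adjacent x y :
  @cyclicly_adjacent relabel x y = @cyclicly_adjacent G (f x) (f y).
Proof.
rewrite !cyclicly_adjacentE /= -[x in LHS]fK -[y in LHS]fK.
by rewrite !next_transport ?rotation_uniq ?fK.
Qed.

Lemma relabel_walk x p y :
  @allowed_walk relabel x p y = @allowed_walk G (f x) p (f y).
Proof. by elim: p x => [|t p IH] x /=; rewrite relabel_adjacent // IH. Qed.

Lemma card_VR_relabel a b c d :
  #|@VR relabel a b c d| = #|@VR G (pi a) (pi b) (pi c) (pi d)|.
Proof.
apply: eq_card => r; rewrite !inE !valid_routesE !relabel_walk.
by rewrite -(map_inj_uniq (can_inj piK) [:: a; b; c; d]).
Qed.

End Relabel.

(** * Linking two gadgets *)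

(** Stated with multiplicities, the covering condition for glued routes becomes linear
    arithmetic. *)
Lemma perm_enumP (T : finType) (w : seq T) :
  reflect (forall e, count_mem e w = 1) (perm_eq w (enum T)).
Proof.
apply: (iffP idP) => [/seq.permP pe e | ct].
  by rewrite pe count_uniq_mem ?enum_uniq // mem_enum.
apply/allP => e _ /=.
by rewrite ct count_uniq_mem ?enum_uniq // mem_enum.
Qed.

(** The first letter satisfying [P] marks the cut. With [P] the property of being a link edge, this
    recovers the pieces of a glued route. *)
Lemma map_cat_cons_inj (A C : Type) (f : A -> C) (P : pred C) p p' t t' w w' :
  injective f -> (forall x, ~~ P (f x)) -> P t -> P t' ->
  map f p ++ t :: w = map f p' ++ t' :: w' -> [/\ p = p', t = t' & w = w'].
Proof.
move=> fI Pf Pt Pt'; elim: p p' => [|x p IH] [|x' p'] //=; first by case=> -> ->.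
- by case=> e; move: (Pf x'); rewrite -e Pt.
- by case=> e; move: (Pf x); rewrite e Pt'.
- by case=> /fI -> /IH[-> -> ->].
Qed.

Lemma map_neq_cat_cons (A C : Type) (f : A -> C) (P : pred C) p p' t w :
  (forall x, ~~ P (f x)) -> P t -> map f p <> map f p' ++ t :: w.
Proof.
move=> Pf Pt pp'.
have : has P (map f p) by rewrite pp' has_cat /= Pt orbT.
by rewrite has_map; elim: p {pp'} => //= x p IH; rewrite (negPf (Pf x)).
Qed.

(** Booleans index the half-edges 0, 1 and 2, 3, so that [~~] gives the partner and one statement
    covers both choices. *)
Definition lower (k : bool) : 'I_4 := if k then h 1 else h 0.
Definition upper (k : bool) : 'I_4 := if k then h 3 else h 2.

Section Composition.
Variables G1 G2 : map_gadget.

Local Notation E1 := (edge G1).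
Local Notation E2 := (edge G2).
Local Notation E := (E1 + E2 + bool)%type.
Local Notation pair1 := (seq (E1 * bool) * seq (E1 * bool))%type.
Local Notation pair2 := (seq (E2 * bool) * seq (E2 * bool))%type.
Local Notation pair := (seq (E * bool) * seq (E * bool))%type.

Let i1 (t : E1 * bool) : E * bool := (inl (inl t.1), t.2).
Let i2 (t : E2 * bool) : E * bool := (inl (inr t.1), t.2).

(* The link edge [inr k] joins the half-edge [upper k] of [G1] (its end [false])
   to the half-edge [lower k] of [G2] (its end [true]). *)
Let f1 (x : end_of E1) : end_of E :=
  match x with
  | inl t => inl (i1 t)
  | inr i => if i < 2 then inr i else inl (inr (i == h 3), false)
  end.
Let f2 (x : end_of E2) : end_of E :=
  match x with
  | inl t => inl (i2 t)
  | inr i => if i < 2 then inl (inr (i == h 1), true) else inr i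
  end.
(** The joint inverse of [f1] and [f2]: the ends of the linked gadget are the disjoint union of the
    ends of [G1] and of [G2], each link edge contributing one end to either side. *)
Let g (x : end_of E) : end_of E1 + end_of E2 :=
  match x with
  | inl (inl (inl e), s) => inl (inl (e, s))
  | inl (inl (inr e), s) => inr (inl (e, s))
  | inl (inr k, false) => inl (inr (upper k))
  | inl (inr k, true) => inr (inr (lower k))
  | inr i => if i < 2 then inl (inr i) else inr (inr i)
  end.

Let f1K x : g (f1 x) = inl x.
Proof.
by case: x => [[e s]|[[|[|[|[|i]]]] lti]] //=; congr (inl (inr _)); apply: val_inj.
Qed.
Let f2K x : g (f2 x) = inr x.
Proof.
by case: x => [[e s]|[[|[|[|[|i]]]] lti]] //=; congr (inr (inr _)); apply: val_inj.
Qed.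
Let gK x : match g x with inl y => f1 y | inr y => f2 y end = x.
Proof.
by case: x => [[[[e|e]|[]] []]|[[|[|[|[|i]]]] lti]] //=.
Qed.
Let f1_inj : injective f1. Proof. by move=> x y /(congr1 g); rewrite !f1K => -[]. Qed.
Let f2_inj : injective f2. Proof. by move=> x y /(congr1 g); rewrite !f2K => -[]. Qed.

Let inc (x : end_of E) : vertex G1 + vertex G2 :=
  match g x with inl y => inl (incident y) | inr y => inr (incident y) end.
Let rot (v : vertex G1 + vertex G2) : 4.-tuple (end_of E) :=
  match v with
  | inl u => map_tuple f1 (rotation u)
  | inr u => map_tuple f2 (rotation u)
  end.
Let rotU v : uniq (rot v).
Proof. by case: v => v /=; rewrite map_inj_uniq ?rotation_uniq. Qed.
Let rotM v x : (x \in rot v) = (inc x == v).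
Proof.
rewrite -[x in LHS]gK /inc; case: v => v; case: (g x) => y /=.
- by rewrite mem_map // mem_rotation.
- by apply/mapP => -[z _ /(congr1 g)]; rewrite f1K f2K.
- by apply/mapP => -[z _ /(congr1 g)]; rewrite f1K f2K.
- by rewrite mem_map // mem_rotation.
Qed.

Definition compose : map_gadget := gadget_of rotU rotM.

(** * Walks in the linked gadget *)

Let adj1 x y : @cyclicly_adjacent compose (f1 x) (f1 y) = cyclicly_adjacent x y.
Proof. by rewrite !cyclicly_adjacentE /= /inc !f1K /= !next_transport ?rotation_uniq. Qed.
Let adj2 x y : @cyclicly_adjacent compose (f2 x) (f2 y) = cyclicly_adjacent x y.
Proof. by rewrite !cyclicly_adjacentE /= /inc !f2K /= !next_transport ?rotation_uniq. Qed.
Let adj12 x y : @cyclicly_adjacent compose (f1 x) (f2 y) = false.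
Proof. by rewrite !cyclicly_adjacentE /= /inc f1K f2K. Qed.
Let adj21 x y : @cyclicly_adjacent compose (f2 x) (f1 y) = false.
Proof. by rewrite cyclicly_adjacent_sym adj12. Qed.

Let walk1 x p y : @allowed_walk compose (f1 x) (map i1 p) (f1 y) = allowed_walk x p y.
Proof.
elim: p x => [|t p IH] x /=; first exact: adj1.
by rewrite -[inl (i1 t)]/(f1 (inl t)) -IH -adj1.
Qed.
Let walk2 x p y : @allowed_walk compose (f2 x) (map i2 p) (f2 y) = allowed_walk x p y.
Proof.
elim: p x => [|t p IH] x /=; first exact: adj2.
by rewrite -[inl (i2 t)]/(f2 (inl t)) -IH -adj2.
Qed.

Let half1 k : inr (lower k) = f1 (inr (lower k)). Proof. by case: k. Qed.
Let half2 k : inr (upper k) = f2 (inr (upper k)). Proof. by case: k. Qed.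
Let link1 k : inl (inr k, false) = f1 (inr (upper k)). Proof. by case: k. Qed.
Let link2 k : inl (inr k, true) = f2 (inr (lower k)). Proof. by case: k. Qed.

(** Adjacent ends belong to the same gadget, so a walk that is in [G1] either stays there to its end
    or is cut at the first link edge, after which it continues in [G2]. *)
Let split1 x p z : @allowed_walk compose (f1 x) p z ->
  (exists p1 y, [/\ p = map i1 p1, z = f1 y & allowed_walk x p1 y]) \/
  (exists p1 k q, [/\ p = map i1 p1 ++ (inr k, false) :: q,
     allowed_walk x p1 (inr (upper k))
   & @allowed_walk compose (f2 (inr (lower k))) q z]).
Proof.
elim: p x => [|[e s] p IH] x /=.
  rewrite -[z]gK; case: (g z) => y; last by rewrite adj12.
  by rewrite adj1 => xy; left; exists [::], y.
case: e => [[e|e]|k].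
- rewrite -[inl (inl (inl e), s)]/(f1 (inl (e, s))) adj1.
  rewrite -[inl (inl (inl e), _)]/(f1 (inl (e, ~~ s))) => /andP[xe /IH].
  case=> [[p1 [y [-> -> W]]]|[p1 [k [q [-> W W']]]]].
    by left; exists ((e, s) :: p1), y; rewrite /= xe.
  by right; exists ((e, s) :: p1), k, q; rewrite /= xe.
- by rewrite -[inl (inl (inr e), s)]/(f2 (inl (e, s))) adj12.
- case: s => /=; first by rewrite link2 adj12.
  rewrite link1 link2 adj1 => /andP[xk W].
  by right; exists [::], k, p.
Qed.

Let split2 x p z : @allowed_walk compose (f2 x) p z ->
  (exists p1 y, [/\ p = map i2 p1, z = f2 y & allowed_walk x p1 y]) \/
  (exists p1 k q, [/\ p = map i2 p1 ++ (inr k, true) :: q,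
     allowed_walk x p1 (inr (lower k))
   & @allowed_walk compose (f1 (inr (upper k))) q z]).
Proof.
elim: p x => [|[e s] p IH] x /=.
  rewrite -[z]gK; case: (g z) => y; first by rewrite adj21.
  by rewrite adj2 => xy; left; exists [::], y.
case: e => [[e|e]|k].
- by rewrite -[inl (inl (inl e), s)]/(f1 (inl (e, s))) adj21.
- rewrite -[inl (inl (inr e), s)]/(f2 (inl (e, s))) adj2.
  rewrite -[inl (inl (inr e), _)]/(f2 (inl (e, ~~ s))) => /andP[xe /IH].
  case=> [[p1 [y [-> -> W]]]|[p1 [k [q [-> W W']]]]].
    by left; exists ((e, s) :: p1), y; rewrite /= xe.
  by right; exists ((e, s) :: p1), k, q; rewrite /= xe.
- case: s => /=; last by rewrite link1 adj21.
  rewrite link1 link2 adj2 => /andP[xk W].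
  by right; exists [::], k, p.
Qed.

(** * Edge multiplicities and gluing of routes *)

Let count1 e p : count_mem (inl (inl e) : E) (@travelled compose (map i1 p)) =
  count_mem e (travelled p).
Proof. by rewrite /travelled -map_comp !count_map; apply: eq_count => -[]. Qed.
Let count12 e p : count_mem (inl (inr e) : E) (@travelled compose (map i1 p)) = 0.
Proof. by elim: p. Qed.
Let count1l k p : count_mem (inr k : E) (@travelled compose (map i1 p)) = 0.
Proof. by elim: p. Qed.
Let count2 e p : count_mem (inl (inr e) : E) (@travelled compose (map i2 p)) =
  count_mem e (travelled p).
Proof. by rewrite /travelled -map_comp !count_map; apply: eq_count => -[]. Qed.
Let count21 e p : count_mem (inl (inl e) : E) (@travelled compose (map i2 p)) = 0.
Proof. by elim: p. Qed.
Let count2l k p : count_mem (inr k : E) (@travelled compose (map i2 p)) = 0.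
Proof. by elim: p. Qed.

Let travelled_cat p q : @travelled compose (p ++ q) = travelled p ++ travelled q.
Proof. exact: map_cat. Qed.
Let travelled_cons t p : @travelled compose (t :: p) = t.1 :: travelled p.
Proof. by []. Qed.

Let countE := (travelled_cat, travelled_cons, count_cat,
  count1, count12, count1l, count2, count21, count2l).

(** Both routes cross from [G1] to [G2], the first over link [k] and the second over the other
    one. *)
Let glueB k (r1 : pair1) (r2 : pair2) : pair :=
  (map i1 r1.1 ++ (inr k, false) :: map i2 r2.1,
   map i1 r1.2 ++ (inr (~~ k), false) :: map i2 r2.2).

(* The route from 0 to 1 stays in [G1]. *)
Let glueA1 k (r1 : pair1) (r2 : pair2) : pair :=
  (map i1 r1.1,
   map i2 r2.1 ++ (inr k, true) :: map i1 r1.2 ++ (inr (~~ k), false) :: map i2 r2.2).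

(* The route from 2 to 3 stays in [G2]. *)
Let glueA2 k (r1 : pair1) (r2 : pair2) : pair :=
  (map i1 r1.1 ++ (inr k, false) :: map i2 r2.1 ++ (inr (~~ k), true) :: map i1 r1.2,
   map i2 r2.2).


(** Once each link is known to be travelled once, covering the linked gadget amounts to covering
    [G1] and [G2] separately. *)
Let perm_glue (w : seq E) (w1 : seq E1) (w2 : seq E2) :
  (forall e, count_mem (inl (inl e)) w = count_mem e w1) ->
  (forall e, count_mem (inl (inr e)) w = count_mem e w2) ->
  (forall k, count_mem (inr k) w = 1) ->
  perm_eq w (enum (edge compose)) = perm_eq w1 (enum E1) && perm_eq w2 (enum E2).
Proof.
move=> c1 c2 cl; apply/perm_enumP/andP => [c | [/perm_enumP d1 /perm_enumP d2]].
  by split; apply/perm_enumP => e; rewrite -?c1 -?c2 c.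
by case=> [[e|e]|k]; rewrite ?c1 ?c2.
Qed.

(** These eight instances of [walk1] and [walk2] have their endpoints in the form that occurs in
    glued routes, for use as rewrite rules. *)
Let walk1_ll i p j : @allowed_walk compose (inr (lower i)) (map i1 p) (inr (lower j)) =
  allowed_walk (inr (lower i)) p (inr (lower j)).
Proof. by rewrite -[RHS]walk1; case: i; case: j. Qed.
Let walk1_lu i p j : @allowed_walk compose (inr (lower i)) (map i1 p) (inl (inr j, false)) =
  allowed_walk (inr (lower i)) p (inr (upper j)).
Proof. by rewrite -[RHS]walk1; case: i; case: j. Qed.
Let walk1_ul i p j : @allowed_walk compose (inl (inr i, false)) (map i1 p) (inr (lower j)) =
  allowed_walk (inr (upper i)) p (inr (lower j)).
Proof. by rewrite -[RHS]walk1; case: i; case: j. Qed.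
Let walk1_uu i p j : @allowed_walk compose (inl (inr i, false)) (map i1 p) (inl (inr j, false)) =
  allowed_walk (inr (upper i)) p (inr (upper j)).
Proof. by rewrite -[RHS]walk1; case: i; case: j. Qed.
Let walk2_ll i p j : @allowed_walk compose (inl (inr i, true)) (map i2 p) (inl (inr j, true)) =
  allowed_walk (inr (lower i)) p (inr (lower j)).
Proof. by rewrite -[RHS]walk2; case: i; case: j. Qed.
Let walk2_lu i p j : @allowed_walk compose (inl (inr i, true)) (map i2 p) (inr (upper j)) =
  allowed_walk (inr (lower i)) p (inr (upper j)).
Proof. by rewrite -[RHS]walk2; case: i; case: j. Qed.
Let walk2_ul i p j : @allowed_walk compose (inr (upper i)) (map i2 p) (inl (inr j, true)) =
  allowed_walk (inr (upper i)) p (inr (lower j)).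
Proof. by rewrite -[RHS]walk2; case: i; case: j. Qed.
Let walk2_uu i p j : @allowed_walk compose (inr (upper i)) (map i2 p) (inr (upper j)) =
  allowed_walk (inr (upper i)) p (inr (upper j)).
Proof. by rewrite -[RHS]walk2; case: i; case: j. Qed.
Let walkE := (walk1_ll, walk1_lu, walk1_ul, walk1_uu,
  walk2_ll, walk2_lu, walk2_ul, walk2_uu).

(** The index [m] in [B] records how the routes use the links. The three hypotheses make gluing a
    bijection from pairs of valid pairs, summed over [m], onto the valid pairs of the linked
    gadget. *)
Let card_glue (B : finType) (glue : B -> pair1 -> pair2 -> pair) a b c d
    (a1 b1 c1 d1 a2 b2 c2 d2 : B -> 'I_4) :
  (forall m m' r1 r1' r2 r2', glue m r1 r2 = glue m' r1' r2' ->
     [/\ m = m', r1 = r1' & r2 = r2']) ->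
  (forall m r1 r2, @valid_routes compose a b c d (glue m r1 r2).1 (glue m r1 r2).2 =
     @valid_routes G1 (a1 m) (b1 m) (c1 m) (d1 m) r1.1 r1.2 &&
     @valid_routes G2 (a2 m) (b2 m) (c2 m) (d2 m) r2.1 r2.2) ->
  (forall p q, @valid_routes compose a b c d p q ->
     exists m r1 r2, (p, q) = glue m r1 r2) ->
  #|VR compose a b c d| = \sum_m
     #|VR G1 (a1 m) (b1 m) (c1 m) (d1 m)| * #|VR G2 (a2 m) (b2 m) (c2 m) (d2 m)|.
Proof.
move=> glueI glueV glueS.
rewrite (@card_VR compose a b c d (flatten [seq
  [seq glue m r1 r2 | r1 <- route_pairs G1 (a1 m) (b1 m) (c1 m) (d1 m),
                     r2 <- route_pairs G2 (a2 m) (b2 m) (c2 m) (d2 m)] | m <- enum B])).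
- rewrite size_flatten /shape -map_comp sumnE big_map big_enum.
  by apply: eq_bigr => m _; rewrite /= size_allpairs !size_route_pairs.
- elim: (enum B) (enum_uniq B) => //= m s IH /andP[ms /IH us].
  rewrite cat_uniq us andbT allpairs_uniq ?route_pairs_uniq //=; last first.
    by move=> [x1 x2] [y1 y2] _ _ /glueI[_ /= -> ->].
  apply/hasPn => r /flatten_mapP[m' m's] /allpairsP[[r1 r2] [_ _ ->]].
  apply/negP => /allpairsP[[r1' r2'] [_ _ /glueI[mm' _ _]]].
  by rewrite -mm' m's in ms.
- move=> [p q]; apply/flatten_mapP/idP.
    move=> [m _ /allpairsP[[r1 r2] [/= R1 R2 pq]]].
    by rewrite -[p]/(p, q).1 -[q]/(p, q).2 pq glueV -!mem_route_pairs R1.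
  move=> V; have [m [r1 [r2 pq]]] := glueS _ _ V.
  move: V; rewrite -[p]/(p, q).1 -[q]/(p, q).2 pq glueV => /andP[R1 R2].
  by exists m; rewrite ?mem_enum // allpairs_f ?mem_route_pairs.
Qed.

Let is_link (t : E * bool) := if t.1 is inr _ then true else false.
Let link_nE1 t : ~~ is_link (i1 t).
Proof. by []. Qed.
Let link_nE2 t : ~~ is_link (i2 t).
Proof. by []. Qed.
Let i1_inj : injective i1. Proof. by move=> [e s] [e' s'] [-> ->]. Qed.
Let i2_inj : injective i2. Proof. by move=> [e s] [e' s'] [-> ->]. Qed.

Let cut1 p p' k k' s s' w w' :
  map i1 p ++ (inr k, s) :: w = map i1 p' ++ (inr k', s') :: w' ->
  [/\ p = p', k = k' & w = w'].
Proof.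
by case/(map_cat_cons_inj (P := is_link) (t := (inr k, s)) (t' := (inr k', s'))
  i1_inj link_nE1 isT isT) => -> [-> _] ->.
Qed.
Let uncut1 p p' k s w : map i1 p <> map i1 p' ++ (inr k, s) :: w.
Proof. exact: (map_neq_cat_cons (P := is_link) (t := (inr k, s)) link_nE1). Qed.
Let cut2 p p' k k' s s' w w' :
  map i2 p ++ (inr k, s) :: w = map i2 p' ++ (inr k', s') :: w' ->
  [/\ p = p', k = k' & w = w'].
Proof.
by case/(map_cat_cons_inj (P := is_link) (t := (inr k, s)) (t' := (inr k', s'))
  i2_inj link_nE2 isT isT) => -> [-> _] ->.
Qed.

(** Half-edges 2 and 3 of the linked gadget belong to [G2], so no walk that ends inside [G1] ends at
    one of them. *)
Let out1 k y : inr (upper k) <> f1 y.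
Proof. by rewrite half2 => /(congr1 g); rewrite f1K f2K. Qed.
Let out2 k y : inr (lower k) <> f2 y.
Proof. by rewrite half1 => /(congr1 g); rewrite f1K f2K. Qed.

Let links (w : seq E) : perm_eq w (enum (edge compose)) ->
  count_mem (inr false) w = 1 /\ count_mem (inr true) w = 1.
Proof. by move/perm_enumP => c; rewrite !c. Qed.

(** Each route passes from [G1] to [G2], hence crosses an odd number of times; with two links, each
    travelled once, each route crosses exactly once. The index [m] is the link of the first
    route. *)
Lemma card_VR_compose_across i k :
  #|VR compose (lower i) (upper k) (lower (~~ i)) (upper (~~ k))| =
  \sum_m #|VR G1 (lower i) (upper m) (lower (~~ i)) (upper (~~ m))| *
         #|VR G2 (lower m) (upper k) (lower (~~ m)) (upper (~~ k))|.
Proof.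
apply: (@card_glue _ glueB).
- move=> m m' [p1 q1] [p1' q1'] [p2 q2] [p2' q2'] [].
  move=> /cut1[-> -> /(inj_map i2_inj) ->] /cut1[-> _ /(inj_map i2_inj) ->].
  by [].
- move=> m [p1 q1] [p2 q2]; rewrite !valid_routesE.
  have U a b : uniq [:: lower a; upper b; lower (~~ a); upper (~~ b)].
    by case: a b => [] [].
  rewrite !U /= !allowed_walk_cat /= !walkE.
  rewrite (@perm_glue _ (travelled p1 ++ travelled q1) (travelled p2 ++ travelled q2)).
  + by do !case: (allowed_walk _ _ _); rewrite /= ?andbF.
  + by move=> e; do 4 rewrite ?countE /=; lia.
  + by move=> e; do 4 rewrite ?countE /=.
  + by move=> e; do 4 rewrite ?countE /=; case: (m); case: e.
- move=> p q; rewrite valid_routesE => /and4P[_].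
  rewrite !half1 => /split1[[p1 [y [_ /out1]]] //|[p1 [m [p' [-> _]]]]].
  (* A first route that returns to [G1] must cross a third time, and three crossings repeat one of
     the two links. *)
  case/split2 => [[p2 [_ [-> _ _]]]|[p2 [m' [p'' [-> _]]]]]; last first.
    case/split1 => [[p3 [y [_ /out1]]] //|[p3 [m'' [p3' [-> _ _]]]]] _.
    move/links; do 4 rewrite ?countE /=; case.
    by case: (m); case: (m'); case: (m'') => /=; lia.
  move=> /split1[[q1 [y [_ /out1]]] //|[q1 [m' [q' [-> _]]]]].
  case/split2 => [[q2 [_ [-> _ _]]]|[q2 [m'' [q'' [-> _ _]]]]] /links;
    do 4 rewrite ?countE /=; case.
    (* Since no link is repeated, the second route takes the one left by the first. *)
    case: (eqVneq m' (~~ m)) => [-> _ _|]; last by case: m' m => [] [].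
    by exists m, (p1, q1), (p2, q2).
  by case: (m); case: (m'); case: (m'') => /=; lia.
Qed.

(** Each route crosses an even number of times, so exactly one of them uses both links, going over
    and back. In the first sum this is the route between 2 and 3, in the second the route between 0
    and 1; [m] is the first link it takes. *)
Lemma card_VR_compose_along i k :
  #|VR compose (lower i) (lower (~~ i)) (upper k) (upper (~~ k))| =
  \sum_m #|VR G1 (lower i) (lower (~~ i)) (upper m) (upper (~~ m))| *
         #|VR G2 (upper k) (lower m) (lower (~~ m)) (upper (~~ k))| +
  \sum_m #|VR G1 (lower i) (upper m) (upper (~~ m)) (lower (~~ i))| *
         #|VR G2 (lower m) (lower (~~ m)) (upper k) (upper (~~ k))|.
Proof.
pose B := (bool * bool)%type.
(* The first component of [b] tells which of the two routes makes the excursion, the second where it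
   begins. *)
pose glue (b : B) := (if b.1 then glueA1 else glueA2) b.2.
pose sel (t : bool) (x y : 'I_4) := if t then x else y.
rewrite (@card_glue B glue _ _ _ _
  (fun=> lower i) (fun b => sel b.1 (lower (~~ i)) (upper b.2))
  (fun b => sel b.1 (upper b.2) (upper (~~ b.2)))
  (fun b => sel b.1 (upper (~~ b.2)) (lower (~~ i)))
  (fun b => sel b.1 (upper k) (lower b.2))
  (fun b => sel b.1 (lower b.2) (lower (~~ b.2)))
  (fun b => sel b.1 (lower (~~ b.2)) (upper k))
  (fun=> upper (~~ k))).
- by rewrite -(pair_bigA _ (fun t m =>
    #|VR G1 (lower i) (sel t (lower (~~ i)) (upper m))
            (sel t (upper m) (upper (~~ m))) (sel t (upper (~~ m)) (lower (~~ i)))| *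
    #|VR G2 (sel t (upper k) (lower m)) (sel t (lower m) (lower (~~ m)))
            (sel t (lower (~~ m)) (upper k)) (upper (~~ k))|)) big_bool.
- move=> [t m] [t' m'] [p1 q1] [p1' q1'] [p2 q2] [p2' q2'].
  rewrite /glue; case: t; case: t' => //=; case.
  + move=> /(inj_map i1_inj) -> /cut2[-> -> /cut1[-> _ /(inj_map i2_inj) ->]].
    by [].
  + by move/uncut1.
  + by move/esym/uncut1.
  + move=> /cut1[-> -> /cut2[-> _ /(inj_map i1_inj) ->]] /(inj_map i2_inj) ->.
    by [].
- move=> [t m] [p1 q1] [p2 q2]; rewrite !valid_routesE /glue /sel.
  case: t; do 3 (rewrite (_ : uniq _ = true); last by case: (m) (i) (k) => [] [] []);
    rewrite /= ?allowed_walk_cat /= ?allowed_walk_cat /= !walkE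
      (@perm_glue _ (travelled p1 ++ travelled q1) (travelled p2 ++ travelled q2)).
  + by do !case: (allowed_walk _ _ _); rewrite /= ?andbF.
  + by move=> e; do 4 rewrite ?countE /=; lia.
  + by move=> e; do 4 rewrite ?countE /=; lia.
  + by move=> e; do 4 rewrite ?countE /=; case: (m); case: e.
  + by do !case: (allowed_walk _ _ _); rewrite /= ?andbF.
  + by move=> e; do 4 rewrite ?countE /=; lia.
  + by move=> e; do 4 rewrite ?countE /=; lia.
  + by move=> e; do 4 rewrite ?countE /=; case: (m); case: e.
- move=> p q; rewrite valid_routesE => /and4P[_].
  rewrite (half1 i) (half2 k) => /split1[[p1 [_ [-> _ _]]]|[p1 [m [p' [-> _]]]]].
    case/split2 => [[q1 [_ [-> _ _]]]|[q1 [m [q' [-> _]]]]].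
      (* If both routes stay in their own gadget, no link is travelled. *)
      by move/links; do 4 rewrite ?countE /=; case.
    case/split1 => [[q2 [y [_ /out1]]] //|[q2 [m' [q2' [-> _]]]]].
    case/split2 => [[q3 [_ [-> _ _]]]|[q3 [m'' [q3' [-> _ _]]]]] /links;
      do 4 rewrite ?countE /=; case.
      case: (eqVneq m' (~~ m)) => [-> _ _|]; last by case: m' m => [] [].
      by exists (true, m), (p1, q2), (q1, q3).
    by case: (m); case: (m'); case: (m'') => /=; lia.
  case/split2 => [[p2 [y [_ /out2]]] //|[p2 [m' [p2' [-> _]]]]].
  case/split1 => [[p3 [_ [-> _ _]]]|[p3 [m'' [p3' [-> _ _]]]]]; last first.
    (* A route from 0 to 1 that leaves [G1] again after returning makes three crossings. *)
    move=> _ /links; do 4 rewrite ?countE /=; case.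
    by case: (m); case: (m'); case: (m'') => /=; lia.
  case/split2 => [[q1 [_ [-> _ _]]]|[q1 [m'' [q' [-> _ _]]]]] /links;
    do 4 rewrite ?countE /=; case.
    case: (eqVneq m' (~~ m)) => [-> _ _|]; last by case: m' m => [] [].
    by exists (false, m), (p1, p3), (p2, q1).
  by case: (m); case: (m'); case: (m'') => /=; lia.
Qed.

End Composition.

(** * Realizable triples *)

Lemma nVR_compose (G1 G2 : map_gadget) :
  [/\ nVR01_23 (compose G1 G2) =
        nVR01_23 G1 * (nVR02_13 G2 + nVR03_12 G2) +
        nVR01_23 G2 * (nVR02_13 G1 + nVR03_12 G1),
      nVR02_13 (compose G1 G2) =
        nVR02_13 G1 * nVR02_13 G2 + nVR03_12 G1 * nVR03_12 G2
    & nVR03_12 (compose G1 G2) =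
        nVR02_13 G1 * nVR03_12 G2 + nVR03_12 G1 * nVR02_13 G2].
Proof.
rewrite /nVR01_23 /nVR02_13 /nVR03_12; split.
- rewrite (card_VR_compose_along G1 G2 false false) !big_bool /=.
  (* Reversing and exchanging routes brings all summands to the three standard label orders. *)
  rewrite (card_VR_reverse G1 (h 0) (h 1) (h 3)) (card_VR_reverse G1 (h 0) (h 3) (h 2)).
  rewrite (card_VR_reverse G1 (h 0) (h 2) (h 3)).
  rewrite (card_VR_reverse1 G2 (h 2) (h 1)) (card_VR_swap G2 (h 1) (h 2)).
  rewrite (card_VR_reverse1 G2 (h 2) (h 0)) (card_VR_reverse1 G2 (h 1) (h 0)).
  by ring.
- rewrite (card_VR_compose_across G1 G2 false false) big_bool /=.
  by rewrite (card_VR_swap G2 (h 1) (h 2)) addnC.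
(* Taking [true] for the upper index exchanges the roles of 2 and 3. *)
- rewrite (card_VR_compose_across G1 G2 false true) big_bool /=.
  by rewrite (card_VR_swap G2 (h 1) (h 3)) addnC.
Qed.

Definition realizable (a b c : nat) := exists G : map_gadget,
  [/\ nVR01_23 G = a, nVR02_13 G = b & nVR03_12 G = c].

(** Transposing the labels 1 and 2 exchanges the pairings 01|23 and 02|13 and preserves 03|12, up to
    reversing a route. *)
Lemma realizable_swap12 a b c : realizable a b c -> realizable b a c.
Proof.
move=> [G [<- <- <-]]; exists (@relabel G (tperm (h 1) (h 2)) (@tpermK _ _ _)).
rewrite /nVR01_23 /nVR02_13 /nVR03_12 !card_VR_relabel !permE /=.
by rewrite (card_VR_reverse G (h 0) (h 3)).
Qed.

Lemma realizable_swap23 a b c : realizable a b c -> realizable a c b.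
Proof.
move=> [G [<- <- <-]]; exists (@relabel G (tperm (h 2) (h 3)) (@tpermK _ _ _)).
rewrite /nVR01_23 /nVR02_13 /nVR03_12 !card_VR_relabel !permE /=.
by rewrite (card_VR_reverse G (h 0) (h 1)).
Qed.

Lemma realizable_compose a b c a' b' c' :
  realizable a b c -> realizable a' b' c' ->
  realizable (a * (b' + c') + a' * (b + c)) (b * b' + c * c') (b * c' + c * b').
Proof.
move=> [G [<- <- <-]] [G' [<- <- <-]]; exists (compose G G').
exact: nVR_compose.
Qed.

Lemma realizable110 : realizable 1 1 0.
Proof. by apply: realizable_swap23; exists single_vertex; exact: nVR_single_vertex. Qed.

(** Realizability up to the positive rational factor [m / k], cross-multiplied to stay in the
    naturals. *)
Definition proportional_realizable (x y z : nat) := exists k m a b c,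
  [/\ 0 < k, 0 < m, k * a = m * x, k * b = m * y & k * c = m * z] /\ realizable a b c.

Lemma proportional_realizable_swap12 x y z :
  proportional_realizable x y z -> proportional_realizable y x z.
Proof.
move=> [k [m [a [b [c [[k0 m0 ax by_ cz] /realizable_swap12 R]]]]]].
by exists k, m, b, a, c.
Qed.

Lemma proportional_realizable_swap23 x y z :
  proportional_realizable x y z -> proportional_realizable x z y.
Proof.
move=> [k [m [a [b [c [[k0 m0 ax by_ cz] /realizable_swap23 R]]]]]].
by exists k, m, a, c, b.
Qed.

(** Subtractive Euclidean algorithm, by induction on [x + y]; the factor [k] is the gcd, unchanged
    by subtraction and read off when the two entries agree. *)
Lemma realizable_two x y : 0 < x -> 0 < y -> exists k a b,
  [/\ 0 < k, x = k * a, y = k * b & realizable a b 0].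
Proof.
have [n] := ubnP (x + y); elim: n x y => // n IH x y.
have [lt_xy | lt_yx | ->] := ltngtP x y.
- move=> xyn x0 y0; have [|||k [a [b [k0 xa yb R]]]] := IH x (y - x); try lia.
  (* Composition with (1, 1, 0) adds to the first entry, so the triple is swapped before and
     after. *)
  exists k, a, (a + b); split=> //; first by rewrite mulnDr -xa -yb; lia.
  apply: realizable_swap12.
  by have := realizable_compose (realizable_swap12 R) realizable110;
    congr realizable; ring.
- move=> xyn x0 y0; have [|||k [a [b [k0 xa yb R]]]] := IH (x - y) y; try lia.
  exists k, (a + b), b; split=> //; first by rewrite mulnDr -xa -yb; lia.
  by have := realizable_compose R realizable110; congr realizable; ring.
- by exists y, 1, 1; rewrite muln1; split=> //; exact: realizable110.
Qed.

Lemma proportional_realizable_two x y : 0 < x -> 0 < y -> proportional_realizable x y 0.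
Proof.
move=> x0 y0; have [k [a [b [k0 -> -> R]]]] := realizable_two x0 y0.
by exists k, 1, a, b, 0; rewrite !mul1n !muln0.
Qed.

Lemma proportional_realizable_three x y z :
  0 < x -> 0 < y -> 0 < z -> proportional_realizable x y z.
Proof.
move=> x0 y0 z0; have yz0 : 0 < y + z by lia.
have [k [b [c [k0 yb zc /realizable_swap23 /realizable_swap12 R]]]] := realizable_two y0 z0.
have [k' [a' [b' [k0' xa yzb R']]]] := realizable_two x0 yz0.
have := realizable_compose R R'; rewrite !mul0n !muln0 !addn0 !add0n => RR.
(* From [y = k * b], [z = k * c], [x = k' * a'] and [y + z = k' * b'], multiplying the composed
   triple by [k * k'] gives [y + z] times (x, y, z). *)
exists (k * k'), (y + z), (a' * (b + c)), (b * b'), (c * b'); split=> //.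
split; rewrite ?muln_gt0 ?k0 //.
- by rewrite xa [in RHS]yb [in RHS]zc; ring.
- by rewrite yzb [in RHS]yb; ring.
- by rewrite yzb [in RHS]zc; ring.
Qed.

(** The strict bounds say that at most one entry vanishes; symmetry moves such an entry to the last
    place. *)
Lemma proportional_realizable_lt x y z n :
  x + y + z = n -> x < n -> y < n -> z < n -> proportional_realizable x y z.
Proof.
move=> xyz xn yn zn.
have [x0|x0] := posnP x.
  rewrite x0; apply/proportional_realizable_swap12/proportional_realizable_swap23.
  by apply: proportional_realizable_two; lia.
have [y0|y0] := posnP y.
  rewrite y0; apply/proportional_realizable_swap23.
  by apply: proportional_realizable_two; lia.
have [->|z0] := posnP z; first exact: proportional_realizable_two.
exact: proportional_realizable_three.
Qed.

(** * From integer triples to rational signatures *)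

Local Open Scope ring_scope.

Lemma natq_fraction (q : rat) : 0 <= q -> exists n d : nat, (0 < d)%N /\ q = n%:R / d%:R.
Proof.
move=> q0; exists `|numq q|%N, `|denq q|%N; rewrite absz_gt0 denq_neq0; split=> //.
rewrite !pmulrn !gez0_abs ?denq_ge0 ?numq_ge0 //.
by rewrite divq_num_den.
Qed.

Lemma has_signature_of (G : map_gadget) (k m x y z n : nat) :
  (0 < k)%N -> (0 < m)%N -> (0 < n)%N -> (x + y + z = n)%N ->
  (k * nVR01_23 G = m * x)%N -> (k * nVR02_13 G = m * y)%N ->
  (k * nVR03_12 G = m * z)%N ->
  has_signature G (x%:R / n%:R, y%:R / n%:R, z%:R / n%:R).
Proof.
move=> k0 m0 n0 xyz ax by_ cz.
have N : (k * nVR G = m * n)%N by rewrite /nVR !mulnDr ax by_ cz -!mulnDr xyz.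
have N0 : (0 < nVR G)%N by move: (muln_gt0 k (nVR G)); rewrite N muln_gt0 m0 n0 k0.
have frac a w : (k * a = m * w)%N -> a%:R / (nVR G)%:R = w%:R / n%:R :> rat.
  move=> kw; apply/eqP; rewrite eqr_div ?pnatr_eq0 -?lt0n // -!natrM eqr_nat.
  by rewrite -(eqn_pmul2l k0) mulnA kw mulnCA N; apply/eqP; ring.
by split=> //; rewrite /signature (frac _ _ ax) (frac _ _ by_) (frac _ _ cz).
Qed.

Theorem theorem5 (alpha beta gamma : rat)
  (halpha : 0 <= alpha < 1) (hbeta : 0 <= beta < 1) (hgamma : 0 <= gamma < 1)
  (hsum : alpha + beta + gamma = 1) :
  exists G : map_gadget, has_signature G (alpha, beta, gamma).
Proof.
case/andP: halpha => /natq_fraction[x [dx [dx0 ex]]] x1.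
case/andP: hbeta => /natq_fraction[y [dy [dy0 ey]]] y1.
case/andP: hgamma => /natq_fraction[z [dz [dz0 ez]]] z1.
(* A common denominator turns the rational hypotheses into natural numerators below [n] with sum
   [n]. *)
pose n := (dx * dy * dz)%N.
have n0 : (0 < n)%N by rewrite !muln_gt0 dx0 dy0.
have nz d : (0 < d)%N -> d%:R != 0 :> rat by rewrite pnatr_eq0 -lt0n.
have {}ex : alpha = (x * dy * dz)%:R / n%:R.
  by rewrite ex !natrM; field; rewrite !nz.
have {}ey : beta = (y * dx * dz)%:R / n%:R.
  by rewrite ey !natrM; field; rewrite !nz.
have {}ez : gamma = (z * dx * dy)%:R / n%:R.
  by rewrite ez !natrM; field; rewrite !nz.
have lt w : w%:R / n%:R < 1 :> rat -> (w < n)%N.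
  by rewrite ltr_pdivrMr ?ltr0n // mul1r ltr_nat.
have sum : (x * dy * dz + y * dx * dz + z * dx * dy = n)%N.
  apply/eqP; rewrite -(eqr_nat rat) !natrD; apply/eqP.
  by rewrite -[LHS](divfK (nz _ n0)) (_ : _ / _ = 1) ?mul1r // !mulrDl -ex -ey -ez.
move: x1 y1 z1; rewrite ex ey ez => /lt x1 /lt y1 /lt z1.
have [k [m [a [b [c [[k0 m0 ax by_ cz] [G [Ga Gb Gc]]]]]]]] :=
  proportional_realizable_lt sum x1 y1 z1.
by exists G; apply: (has_signature_of k0 m0); rewrite ?Ga ?Gb ?Gc.
Qed.
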